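(* Let $G$ be a sofic group, let $H$ be a monotileably amenable subgroup of $G$, let $\theta:H\to G$ be an injective group homomorphism, and let $\Gamma=G*_\theta$ be the HNN extension of $G$ relative to $\theta$. Then $\Gamma$ is sofic.
   Context: The HNN extension $G*_\theta$ is the group generated by $G$ and an extra generator $t$ with the added relations $t^{-1}ht=\theta(h)$ for all $h\in H$. For permutations $\sigma,\tau\in S_n$, the normalized Hamming distance $\operatorname{dist}(\sigma,\tau)$ is the number of points not fixed by $\sigma^{-1}\tau$, divided by $n$. A group $\Gamma$ (with identity $e$) is sofic if for every finite subset $F\subseteq\Gamma$ and every $\epsilon>0$ there exist an integer $n\ge 1$ and a map $\phi:\Gamma\to S_n$ such that (i) for every $g\in F\setminus\{e\}$, $\operatorname{dist}(\phi(g),\mathrm{id})>1-\epsilon$, and (ii) for all $g_1,g_2\in F$, $\operatorname{dist}(\phi(g_1^{-1}g_2),\phi(g_1)^{-1}\phi(g_2))<\epsilon$. For a group $G$, a finite set $K\subseteq G$ and $\epsilon>0$, a finite set $F\subseteq G$ is $(K,\epsilon)$-invariant if $|KF\setminus F|<\epsilon|F|$. A tile (or monotile) for $G$ is a finite set $T\subseteq G$ such that $G$ is a disjoint union of right translates of $T$; equivalently, there is a set $C\subseteq G$ (of centers) such that the map $T\times C\to G$, $(t,c)\mapsto tc$, is a bijection. A group $G$ is monotileably amenable if for every finite set $K\subseteq G$ and every $\epsilon>0$ there is a tile $T$ for $G$ that is $(K,\epsilon)$-invariant. *)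

(* Defs.v *)
From HB Require Import structures.
From mathcomp Require Import all_boot all_order all_fingroup all_algebra.
From mathcomp Require Import generic_quotient finmap boolp classical_sets functions reals.

Set Implicit Arguments.
Unset Strict Implicit.
Unset Printing Implicit Defensive.

Import Order.TTheory GRing.Theory Num.Theory.

Local Open Scope ring_scope.

Section Sofic.
Variable R : realType.

Definition hamming_dist (n : nat) (s t : 'S_n) : R :=
  #|[set i : 'I_n | (s^-1 * t)%g i != i]|%:R / n%:R.

(* The product of ['S_n] composes from left to right.  The opposite convention
   defines the same class of groups: replace [phi g] by its inverse. *)
Definition sofic (G : groupType) : Prop :=
  forall (F : {fset G}) (eps : R), 0 < eps ->
  exists (n : nat) (phi : G -> 'S_n),
    [/\ (0 < n)%N,
        forall g, g \in F -> g <> 1%g -> 1 - eps < hamming_dist (phi g) 1%g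
      & forall g1 g2, g1 \in F -> g2 \in F ->
          hamming_dist (phi (g1^-1 * g2)%g) ((phi g1)^-1 * phi g2)%g < eps].

End Sofic.

Section Monotileable.
Variable G : groupType.
Local Open Scope fset_scope.

Definition invariant_fset (R : realType) (K : {fset G}) (eps : R)
    (F : {fset G}) : Prop :=
  #|` [fset (k * f)%g | k in K, f in F] `\` F|%:R < eps * #|` F|%:R.

Definition tile (T : {fset G}) : Prop :=
  exists C : set G,
    set_bij ([set` T] `*` C)%classic [set: G]%classic
      (fun p : G * G => (p.1 * p.2)%g).

Definition monotileably_amenable (R : realType) : Prop :=
  forall (K : {fset G}) (eps : R), 0 < eps ->
  exists2 T : {fset G}, tile T & invariant_fset K eps T.

End Monotileable.

Section HNN.
Variables (G : groupType) (S : pred G) (H : subGroupType S).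
Variable theta : UMagmaMorphism.type H G.

(* Words in the elements of G and the letters t (encoded by [inr true]) and
   t^-1 (encoded by [inr false]). *)
Definition hnn_word := seq (G + bool).

(* The congruence on words whose quotient is the group generated by G and t
   with the relations t^-1 h t = theta h for h in H. *)
Inductive hnn_eq : hnn_word -> hnn_word -> Prop :=
| HnnRefl u : hnn_eq u u
| HnnSym u v : hnn_eq u v -> hnn_eq v u
| HnnTrans u v w : hnn_eq u v -> hnn_eq v w -> hnn_eq u w
| HnnCat u u' v v' : hnn_eq u u' -> hnn_eq v v' -> hnn_eq (u ++ v) (u' ++ v')
| HnnOne : hnn_eq [:: inl 1%g] [::]
| HnnMul g g' : hnn_eq [:: inl g; inl g'] [:: inl (g * g')%g]
| HnnInv b : hnn_eq [:: inr b; inr (~~ b)] [::]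
| HnnRel (h : H) :
    hnn_eq [:: inr false; inl (val h); inr true] [:: inl (theta h)].

Definition hnn_eqb : rel hnn_word := fun u v => `[< hnn_eq u v >].

Lemma hnn_eqb_refl : reflexive hnn_eqb.
Proof. by move=> u; apply/asboolP; apply: HnnRefl. Qed.

Lemma hnn_eqb_sym : symmetric hnn_eqb.
Proof. by move=> u v; apply/asboolP/asboolP => /HnnSym. Qed.

Lemma hnn_eqb_trans : transitive hnn_eqb.
Proof.
by move=> v u w /asboolP uv /asboolP vw; apply/asboolP; apply: HnnTrans uv vw.
Qed.

Canonical hnn_equiv :=
  EquivRel hnn_eqb hnn_eqb_refl hnn_eqb_sym hnn_eqb_trans.

Definition HNN : Type := {eq_quot hnn_equiv}%qT.
HB.instance Definition _ := Choice.on HNN.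
HB.instance Definition _ := EqQuotient.on HNN.

Local Open Scope quotient_scope.

Lemma hnn_piP u v : hnn_eq u v <-> \pi_HNN u = \pi_HNN v.
Proof.
split=> [uv|/eqquotP/asboolP //].
by apply/eqquotP; apply/asboolP.
Qed.

Lemma hnn_eq_repr u : hnn_eq (repr (\pi_HNN u)) u.
Proof. by apply/hnn_piP; rewrite reprK. Qed.

Definition hnn_invl (l : G + bool) : G + bool :=
  match l with inl g => inl g^-1%g | inr b => inr (~~ b) end.

Definition hnn_invw (u : hnn_word) : hnn_word := rev (map hnn_invl u).

Lemma hnn_eq_inv u v : hnn_eq u v -> hnn_eq (hnn_invw u) (hnn_invw v).
Proof.
rewrite /hnn_invw; elim=> {u v}.
- by move=> u; apply: HnnRefl.
- by move=> u v _; apply: HnnSym.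
- by move=> u v w _ uv _; apply: HnnTrans.
- by move=> u u' v v' _ IHu _ IHv; rewrite !map_cat !rev_cat; apply: HnnCat.
- by rewrite /rev /= invg1; apply: HnnOne.
- by move=> g g'; rewrite /rev /= invgM; apply: HnnMul.
- by move=> b; rewrite /rev /= negbK; apply: HnnInv.
- by move=> h; have := HnnRel h^-1%g; rewrite !gmulfV.
Qed.

Lemma hnn_eqVl u : hnn_eq (hnn_invw u ++ u) [::].
Proof.
elim: u => [|l u IHu]; first exact: HnnRefl.
have lVl : hnn_eq [:: hnn_invl l; l] [::].
  case: l => [g|b] /=.
    by apply: HnnTrans (HnnMul _ _) _; rewrite mulVg; apply: HnnOne.
  by have := HnnInv (~~ b); rewrite negbK.
apply: HnnTrans IHu; rewrite /hnn_invw /= rev_cons cat_rcons.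
apply: HnnCat (HnnRefl _) _; rewrite -[u in X in hnn_eq _ X]cat0s.
exact: (HnnCat lVl (HnnRefl u)).
Qed.

Definition hnn_one : HNN := \pi_HNN [::].
Definition hnn_mul (x y : HNN) : HNN := \pi_HNN (repr x ++ repr y).
Definition hnn_inv (x : HNN) : HNN := \pi_HNN (hnn_invw (repr x)).

Lemma hnn_mul_pi u v : hnn_mul (\pi_HNN u) (\pi_HNN v) = \pi_HNN (u ++ v).
Proof. by apply/hnn_piP; apply: HnnCat; apply: hnn_eq_repr. Qed.

Lemma hnn_inv_pi u : hnn_inv (\pi_HNN u) = \pi_HNN (hnn_invw u).
Proof. by apply/hnn_piP; apply: hnn_eq_inv; apply: hnn_eq_repr. Qed.

Lemma hnn_mulA : associative hnn_mul.
Proof.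
elim/quotW=> u; elim/quotW=> v; elim/quotW=> w.
by rewrite (hnn_mul_pi v) (hnn_mul_pi u) (hnn_mul_pi u) hnn_mul_pi catA.
Qed.

Lemma hnn_mul1 : left_id hnn_one hnn_mul.
Proof. by elim/quotW=> u; rewrite hnn_mul_pi. Qed.

Lemma hnn_mulr1 : right_id hnn_one hnn_mul.
Proof. by elim/quotW=> u; rewrite hnn_mul_pi cats0. Qed.

Lemma hnn_mulV : left_inverse hnn_one hnn_inv hnn_mul.
Proof.
elim/quotW=> u; rewrite hnn_inv_pi hnn_mul_pi.
by apply/hnn_piP; apply: hnn_eqVl.
Qed.

Lemma hnn_mulrV : right_inverse hnn_one hnn_inv hnn_mul.
Proof.
move=> x; rewrite -[LHS]hnn_mul1 -{1}(hnn_mulV (hnn_inv x)) -hnn_mulA.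
by rewrite [hnn_mul (hnn_inv x) _]hnn_mulA hnn_mulV hnn_mul1 hnn_mulV.
Qed.

HB.instance Definition _ :=
  isGroup.Build HNN hnn_mulA hnn_mul1 hnn_mulr1 hnn_mulV hnn_mulrV.

Definition hnn_base (g : G) : HNN := \pi_HNN [:: inl g].
Definition hnn_stable : HNN := \pi_HNN [:: inr true].

Lemma hnn_baseM : {morph hnn_base : g g' / (g * g')%g}.
Proof.
move=> g g'; rewrite /hnn_base [RHS]hnn_mul_pi; apply/hnn_piP.
by apply: HnnSym; apply: HnnMul.
Qed.

Lemma hnn_base1 : hnn_base 1%g = 1%g.
Proof. by apply/hnn_piP; apply: HnnOne. Qed.

HB.instance Definition _ := isMultiplicative.Build G HNN hnn_base hnn_baseM.
HB.instance Definition _ :=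
  Multiplicative_isUMagmaMorphism.Build G HNN hnn_base hnn_base1.

Lemma hnn_relation (h : H) :
  (hnn_stable^-1 * hnn_base (val h) * hnn_stable)%g = hnn_base (theta h).
Proof.
rewrite -[LHS]/(hnn_mul (hnn_mul (hnn_inv hnn_stable) _) _).
rewrite /hnn_base /hnn_stable hnn_inv_pi (hnn_mul_pi _ [:: inl _]) hnn_mul_pi.
by apply/hnn_piP; apply: HnnRel.
Qed.

Section UniversalProperty.
Variables (K : groupType) (f : UMagmaMorphism.type G K) (s : K).
Hypothesis fs : forall h : H, (s^-1 * f (val h) * s)%g = f (theta h).

Definition hnn_evall (l : G + bool) : K :=
  match l with inl g => f g | inr b => if b then s else (s^-1)%g end.

Definition hnn_evalw (u : hnn_word) : K := (\prod_(l <- u) hnn_evall l)%g.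

Definition hnn_eval (x : HNN) : K := hnn_evalw (repr x).

Lemma hnn_evalw_eq u v : hnn_eq u v -> hnn_evalw u = hnn_evalw v.
Proof.
rewrite /hnn_evalw; elim=> {u v}.
- by [].
- by move=> u v _ ->.
- by move=> u v w _ -> _ ->.
- by move=> u u' v v' _ IHu _ IHv; rewrite !big_cat /= IHu IHv.
- by rewrite big_seq1 big_nil /= gmulf1.
- by move=> g g'; rewrite big_cons !big_seq1 /= gmulfM.
- by case; rewrite big_cons big_seq1 big_nil /= ?mulgV ?mulVg.
- by move=> h; rewrite !big_cons big_nil /= !mulg1 mulgA fs.
Qed.

Lemma hnn_eval_pi u : hnn_eval (\pi_HNN u) = hnn_evalw u.
Proof. by apply: hnn_evalw_eq; apply: hnn_eq_repr. Qed.

Lemma hnn_eval_base g : hnn_eval (hnn_base g) = f g.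
Proof. by rewrite hnn_eval_pi /hnn_evalw big_seq1. Qed.

Lemma hnn_eval_stable : hnn_eval hnn_stable = s.
Proof. by rewrite hnn_eval_pi /hnn_evalw big_seq1. Qed.

Lemma hnn_evalM : {morph hnn_eval : x y / (x * y)%g}.
Proof.
elim/quotW=> u; elim/quotW=> v; rewrite -[LHS]/(hnn_eval (hnn_mul _ _)).
by rewrite hnn_mul_pi !hnn_eval_pi /hnn_evalw big_cat.
Qed.

End UniversalProperty.

End HNN.

(* Main.v *)
Require Import Defs.
From HB Require Import structures.
From mathcomp Require Import all_boot all_order all_fingroup all_algebra.
From mathcomp Require Import finmap boolp classical_sets functions reals.
From mathcomp Require Import generic_quotient zify lra.
From mathcomp Require Import fintype finset.

(** Let [phi] be a model of [G] by permutations of a finite set [X], exact and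
free outside a few bad points.  Composing it with the inclusion of [H] and with
[theta] gives two almost free almost actions of [H] on the same set.  Since [H]
is amenable they are almost conjugate: [near_conjugacy] yields a permutation
[sigma] of [X] that transports the first to the second at most points, so that
letting t act as [sigma] makes the relations t^-1 h t = theta h almost true.

This does not yet separate the elements of the extension from 1, and the shape
of [sigma] is used for that.  Most of [X] is cut into pieces, each of which is
almost all of a translate x T of a finite subset T of [H], and [sigma] sends the
point x s of a piece to y (theta s).  Let [c] name the piece of a point, and
attach to the pieces p permutations [q p] of a finite set [B] that satisfy no
short relation; truncating the left regular action of a free group to a ball
provides them ([exists_free_perms]).  On [X * {perm B}] let [G] act on the first
factor and t send (x, z) to (sigma x, z (q (c x))).  Since [c] is constant on
pieces, the relations still hold at most points.  Now read a word g0 t^e1 g1 ...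
t^ek gk from a point (x, z): the second coordinate gets multiplied by a product
of k permutations [q p] or their inverses, where the p are the pieces met on the
way.  It can be trivial only if two consecutive factors cancel, that is, if
between a letter t^-1 and a letter t (or the other way round) some gi maps a
point of a piece, or of the image of a piece under [sigma], to a point of the
same piece or image.  But two points of one piece differ by an element of [H],
and their images under [sigma] by an element of [theta H]; as [phi] is free at
these points, gi itself is that element, and the word contains a subword t^-1 h
t or t (theta h) t^-1 ([labels_freely_reduced]).  Every element of the extension
is represented by a word without such subwords ([exists_normal_form]); if the
element is not 1, this word therefore moves most points of [X * {perm B}].

The almost conjugacy is built greedily, after Ornstein and Weiss.  For a Folner
set T, take points x and y whose translates x T and y T hardly meet what is
already used on the source and on the target side, match x s with y s for all s
where both points are new, and repeat.  When no such pair is left, the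
translates of almost all points on one of the two sides meet the used part in a
fixed proportion; if the part that was used before T came into play has a small
boundary with respect to T, double counting shows that a fixed fraction of [X]
has been added ([saturated_growth]).  Running through boundedly many Folner
sets, each much less invariant than its predecessor, exhausts one side, hence
both ([exists_large_matching]).

Permutations compose from left to right, so all actions are right actions.
Smallness of a set of points is written [m * #|bad| <= #|X|]. *)

Set Implicit Arguments.
Unset Strict Implicit.
Unset Printing Implicit Defensive.

Import Order.TTheory GRing.Theory Num.Theory.

(** * Permutations of a finite set *)

Section Disagreement.
Variable X : finType.
Implicit Types p q r : {perm X}.

(** The Hamming distance, not divided by the number of points. *)
Definition dis p q := #|[set x | p x != q x]|.

Lemma dis_sym p q : dis p q = dis q p.
Proof. by apply: eq_card => x; rewrite !inE eq_sym. Qed.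

Lemma dis_triangle q p r : dis p r <= dis p q + dis q r.
Proof.
apply: leq_trans (leq_card_setU _ _); apply/subset_leq_card/subsetP => x.
by rewrite !inE -negb_and; apply: contra => /andP[/eqP-> /eqP->].
Qed.

Lemma dis_mulr p q r : dis (p * r)%g (q * r)%g = dis p q.
Proof. by apply: eq_card => x; rewrite !inE !permM (inj_eq perm_inj). Qed.

Lemma dis_eq p q : p = q -> dis p q = 0.
Proof. by move->; apply: eq_card0 => x; rewrite !inE eqxx. Qed.

Lemma dis_le p q (E : {set X}) : (forall x, x \notin E -> p x = q x) ->
  dis p q <= #|E|.
Proof.
move=> pq; apply/subset_leq_card/subsetP => x; rewrite inE.
by apply: contraR => /pq->.
Qed.

Lemma card_preim_perm p (E : {set X}) : #|[set x | p x \in E]| = #|E|.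
Proof.
rewrite -[RHS](card_preimset _ (@perm_inj _ p)).
by apply: eq_card => x; rewrite !inE.
Qed.

Lemma dis_mull p q r : dis (r * p)%g (r * q)%g = dis p q.
Proof.
rewrite -[RHS](card_preim_perm r).
by apply: eq_card => x; rewrite !inE !permM.
Qed.

(** Having few fixed points is stable under small perturbations: the left-hand
side counts the fixed points of [p]. *)
Lemma agree1_le p q :
  #|X| - dis p 1%g <= dis p q + #|[set x | q x == x]|.
Proof.
have : #|X| <= #|[set x | q x == x]| + dis q 1%g.
  rewrite -(cardsC [set x | q x == x]) leq_add2l.
  by apply/subset_leq_card/subsetP => x; rewrite !inE perm1.
by have := dis_triangle p q 1%g; rewrite (dis_sym q p); lia.
Qed.

End Disagreement.

(** The complements of the domain and of the image have the same size, so the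
injection extends by one point at a time. *)
Lemma perm_extension (X : finType) (f : X -> X) (D : {set X}) :
  {in D &, injective f} -> exists p : {perm X}, {in D, p =1 f}.
Proof.
have [r] := ubnP #|~: D|; elim: r f D => // r IHr f D leDr injf.
have [D0|[x]] := set_0Vmem (~: D).
  have injF : injective f.
    move=> x y; apply: injf; rewrite -[D]setCK D0 inE ?in_set0 //.
  by exists (perm injF) => x _; rewrite permE.
rewrite inE => xD.
have [y yD] : exists y, y \notin f @: D.
  apply/existsP; apply: contraLR xD; rewrite negb_exists => /forallP fD.
  have : #|f @: D| = #|X|.
    by apply: eq_card => y; rewrite inE; have := fD y; rewrite negbK.
  rewrite card_in_imset // negbK => /eqP; rewrite -cardsT => eqD.
  have/eqP-> : D == setT by rewrite eqEcard subsetT -(eqP eqD) leqnn.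
  by rewrite inE.
pose f' z := if z == x then y else f z.
have f'D z : z \in D -> f' z = f z.
  by rewrite /f'; case: eqP => // ->; rewrite (negPf xD).
have [||p pf'] := IHr f' (x |: D).
- rewrite -ltnS; apply: leq_trans leDr; rewrite ltnS.
  apply: proper_card; apply/properP; split.
    by rewrite setCS subsetUr.
  by exists x; rewrite !inE ?eqxx.
- have f'x : f' x = y by rewrite /f' eqxx.
  move=> u v /setU1P[->|uD] /setU1P[->|vD] //; rewrite ?f'x ?f'D //.
  + by move=> yv; case/imsetP: yD; exists v.
  + by move=> yu; case/imsetP: yD; exists u.
  + exact: injf.
by exists p => z zD; rewrite pf' ?f'D // inE zD orbT.
Qed.

(** * Permutations without short relations *)

Section FreePermutations.
Variable P : eqType.

Definition freely_reduced (s : seq (P * bool)) : bool :=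
  sorted (fun l l' => l' != (l.1, ~~ l.2)) s.

Definition perm_word (B : finType) (q : P -> {perm B}) (s : seq (P * bool)) :
    {perm B} :=
  (\prod_(l <- s) (if l.2 then q l.1 else (q l.1)^-1))%g.

End FreePermutations.

(** The points are the words of length at most [k], used as stacks.  The letter
(p, b) should push itself, or pop (p, ~~ b) if that is on top; this is a partial
injection, and any extension of it to a permutation serves as [q p].  A freely
reduced word of length at most [k], applied to the empty stack, never pops, and
ends in its own reversal. *)
Lemma exists_free_perms (P : finType) (k : nat) :
  exists (B : finType) (q : P -> {perm B}), forall s,
    0 < size s <= k -> freely_reduced s -> perm_word q s != 1%g.
Proof.
pose B : finType := k.-bseq (P * bool).
pose mk (w : seq (P * bool)) : B := insub_bseq k w.
have mkE w : size w <= k -> mk w = w :> seq _.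
  by move=> wk; rewrite /mk /insub_bseq val_insubd wk.
pose ends (l : P * bool) (w : seq (P * bool)) := ohead w == Some l.
pose push p : {set B} := [set w : B | (size w < k) && ~~ ends (p, false) w].
(* Requiring a second letter other than (p, true) in the domain of pop makes
   the images of push and pop disjoint. *)
pose pop p : {set B} :=
  [set w : B | ends (p, false) w && ~~ ends (p, true) (behead w)].
pose f p (w : B) : B :=
  mk (if ends (p, false) w then behead w else (p, true) :: w).
have fpush p w : w \in push p -> f p w = (p, true) :: w :> seq _.
  by rewrite inE /f => /andP[wk /negPf->]; rewrite mkE.
have fpop p w : w \in pop p -> f p w = behead w :> seq _.
  rewrite inE /f => /andP[-> _]; rewrite mkE // size_behead.
  by rewrite (leq_trans (leq_pred _)) // size_bseq.
have injf p : {in push p :|: pop p &, injective (f p)}.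
  have mix u v : u \in push p -> v \in pop p -> f p u <> f p v.
    move=> uu vv /(congr1 (@bseqval _ _)) /=; rewrite fpush // fpop // => fuv.
    by move: vv; rewrite inE -fuv /ends /= eqxx andbF.
  move=> u v /setUP[uu|uu] /setUP[vv|vv] fuv.
  - move/(congr1 (@bseqval _ _)): (fuv) => /=; rewrite !fpush // => -[uv].
    exact: val_inj.
  - by case: (mix u v).
  - by case: (mix v u).
  - move/(congr1 (@bseqval _ _)): (fuv) => /=; rewrite !fpop // => bb.
    apply: val_inj => /=; move: uu vv bb; rewrite !inE /ends /=.
    case: (bseqval u) => [|a u'] //=; case: (bseqval v) => [|b v'] //=.
    by move=> /andP[/eqP[->] _] /andP[/eqP[->] _] ->.
have [q qE] : exists q : P -> {perm B},
    forall p, {in push p :|: pop p, q p =1 f p}.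
  have ex p : exists g : {ffun P -> {perm B}},
      [forall w in push p :|: pop p, g p w == f p w].
    have [g gE] := perm_extension (@injf p).
    by exists [ffun=> g]; apply/forall_inP => w wD; rewrite ffunE gE.
  exists (fun p => xchoose (ex p) p) => p w wD.
  by move/forall_inP: (xchooseP (ex p)) => /(_ w wD)/eqP.
pose act (l : P * bool) := (if l.2 then q l.1 else (q l.1)^-1)%g.
have actE l w : size w < k -> ~~ ends (l.1, ~~ l.2) w ->
    act l (mk w) = mk (l :: w).
  case: l => p [] /= wk wl.
    have wP : mk w \in push p by rewrite inE mkE ?wk // ltnW.
    rewrite /act /= qE; last by rewrite in_setU wP.
    by apply: val_inj => /=; rewrite fpush // !mkE // ltnW.
  rewrite /act /=; apply: (@perm_inj _ (q p)); rewrite permKV.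
  have wP : mk ((p, false) :: w) \in pop p by rewrite inE mkE // /ends /= eqxx.
  rewrite qE; last by rewrite in_setU wP orbT.
  by apply: val_inj => /=; rewrite fpop // !mkE // ltnW.
exists B, q => s /andP[s0 sk] red.
have main w : size s + size w <= k ->
    (if s is l :: _ then ~~ ends (l.1, ~~ l.2) w else true) ->
    perm_word q s (mk w) = mk (catrev s w).
  elim: s w red {s0 sk} => [|l s IHs] w red sk wl.
    by rewrite /perm_word big_nil perm1.
  rewrite /perm_word big_cons permM -/(act l) actE //; last first.
    by move: sk => /=; lia.
  have ssk : size s + size (l :: w) <= k by move: sk => /=; lia.
  apply: IHs ssk _; first exact: path_sorted red.
  case: s red {sk} => //= l' s /andP[+ _].
  apply: contra => /eqP[->] /=.
  by case: (l') => p b /=; rewrite negbK.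
apply: contraTneq s0 => /(congr1 (fun p : {perm B} => p (mk [::]))).
rewrite main ?addn0 //; last by case: (s).
rewrite perm1 => /(congr1 (@bseqval _ _)) /=; rewrite !mkE ?size_rev //.
by move=> /(congr1 size); rewrite size_rev => ->.
Qed.

(** * Matching two almost actions of an amenable group *)

Section Matching.
Variable H : groupType.
Implicit Types (K L T : seq H) (h k s t : H).

(** Membership in the inner boundary of [T], which is small for a Folner set. *)
Definition broken K T s := ~~ all (fun k => (s * k)%g \in T) K.

Definition right_folner K m T :=
  [/\ uniq T, 0 < size T & m * count (broken K T) T <= size T].

Section OneSide.
Variable X : finType.
Implicit Types (a b : H -> {perm X}) (A D E : {set X}).

(** Outside [E], the map [a] behaves like a free right action as far as the
elements of [L] can tell.  Multiplicativity at (1, 1) already forces [a 1] to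
fix the points outside [E]. *)
Definition near_action L a E := forall x, x \notin E ->
  {in L &, forall h k, a (h * k)%g x = a k (a h x)} /\
  {in L &, injective (fun h => a h x)}.

Definition boundary K a A :=
  [set z | (z \notin A) && has (fun k => a k z \in A) K].

Definition orb a x T := [set z in [seq a s x | s <- T]].

Lemma orbP a x T z : reflect (exists2 s, s \in T & z = a s x) (z \in orb a x T).
Proof. by rewrite inE; apply: mapP. Qed.

Lemma mem_orb a x T s : s \in T -> a s x \in orb a x T.
Proof. by move=> sT; apply/orbP; exists s. Qed.

Lemma card_seq_le (Y : finType) (s : seq Y) : #|[set z in s]| <= size s.
Proof. by rewrite cardsE card_size. Qed.

Lemma card_orb_le a x T : #|orb a x T| <= size T.
Proof. by rewrite -(size_map (fun s => a s x)) card_seq_le. Qed.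

Lemma card_orb L a E x T : near_action L a E -> x \notin E ->
  {subset T <= L} -> uniq T -> #|orb a x T| = size T.
Proof.
move=> na xE TL uT; rewrite cardsE -(size_map (fun s => a s x)).
apply/card_uniqP; rewrite map_inj_in_uniq // => s t sT tT.
by apply: (na x xE).2; apply: TL.
Qed.

(** A boundary point z of x T that [k] moves to x s is x (s k^-1) with [s *
k^-1] outside [T], so a Folner set has translates with small boundary whether or
not they overlap the set [A]. *)
Lemma boundary_add L a E x K T A : near_action L a E -> x \notin E ->
  {subset K <= L} -> {in T & K, forall s k, (s * k^-1)%g \in L} ->
  #|boundary K a (A :|: orb a x T)| <=
    #|boundary K a A| + size K * count (broken [seq k^-1%g | k <- K] T) T.
Proof.
move=> na xE KL TKL.
pose bad := [seq s <- T | broken [seq k^-1%g | k <- K] T s].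
pose Z := [set z in [seq a (s * k^-1)%g x | k <- K, s <- bad]].
have leZ : #|Z| <= size K * count (broken [seq k^-1%g | k <- K] T) T.
  rewrite -size_filter -(size_allpairs (fun k s => a (s * k^-1)%g x)).
  exact: card_seq_le.
apply: leq_trans (leq_trans (leq_card_setU (boundary K a A) Z) _); last first.
  by rewrite leq_add2l.
apply/subset_leq_card/subsetP => z; rewrite !inE negb_or -andbA.
case/and3P=> zA zT /hasP[k kK]; rewrite in_setU => /orP[akA|].
  by rewrite zA; apply/orP; left; apply/hasP; exists k.
case/orbP=> s sT akz; apply/orP; right.
have zE : z = a (s * k^-1)%g x.
  apply: (@perm_inj _ (a k)); rewrite akz.
  by rewrite -(na x xE).1 ?mulgKV //; [apply: TKL | apply: KL].
apply/allpairsP; exists (k, s); split=> //=.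
rewrite mem_filter sT andbT; apply/allPn; exists k^-1%g; first exact: map_f.
by apply: contra zT => skT; rewrite zE map_f.
Qed.

End OneSide.

Section TwoSides.
Variable X : finType.
Implicit Types (a b : H -> {perm X}) (A B D E : {set X}).

(** [pm_map] matches [pm_dom] with part of [pm_tgt], and [pm_lab] names the
piece of a point of [pm_dom] by one of the points of that piece.  [pm_src] and
[pm_tgt] are the unions of all translates chosen so far: they also contain the
points lost because their partner had been used before.  Keeping these points is
what gives both sets small boundaries. *)
Record partial_matching := PartialMatching {
  pm_dom : {set X}; pm_src : {set X}; pm_tgt : {set X};
  pm_map : X -> X; pm_lab : X -> X }.

Definition violations K a b (w : partial_matching) :=
  [set x in pm_dom w | ~~ all (fun k => [&& a k x \in pm_dom w,
      pm_map w (a k x) == b k (pm_map w x) & pm_lab w (a k x) == pm_lab w x]) K].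

(** All inequalities compare a defect with the size of the domain.  Adding a
piece enlarges both sides, so each of them only has to be checked for the new
piece. *)
Record matching_ok K0 K L m M a b (w : partial_matching) : Prop := MatchingOk {
  ok_src : pm_dom w \subset pm_src w;
  ok_map : {in pm_dom w, forall x, pm_map w x \in pm_tgt w};
  ok_inj : {in pm_dom w &, injective (pm_map w)};
  ok_lab : {in pm_dom w, forall x, pm_lab w x \in pm_dom w};
  ok_wsrc : m * #|pm_src w :\: pm_dom w| <= #|pm_dom w|;
  ok_wtgt : m * #|pm_tgt w :\: pm_map w @: pm_dom w| <= #|pm_dom w|;
  ok_bsrc : M * #|boundary K a (pm_src w)| <= #|pm_dom w|;
  ok_btgt : M * #|boundary K b (pm_tgt w)| <= #|pm_dom w|;
  ok_viol : m * #|violations K0 a b w| <= #|pm_dom w|;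
  ok_piece : {in pm_dom w &, forall u v, pm_lab w u = pm_lab w v ->
     (exists2 h, h \in L & v = a h u) /\
     (exists2 h, h \in L & pm_map w v = b h (pm_map w u))} }.

Lemma matching_ok_weaken K0 K K' L L' m M M' a b w :
  matching_ok K0 K L m M a b w -> {subset K' <= K} -> {subset L <= L'} ->
  M' <= M -> matching_ok K0 K' L' m M' a b w.
Proof.
move=> ok sK sL leM; have sb (c : H -> {perm X}) A :
    M' * #|boundary K' c A| <= M * #|boundary K c A|.
  apply: leq_mul => //; apply/subset_leq_card/subsetP => z.
  rewrite !inE => /andP[-> /hasP[k kK]] ? /=.
  by apply/hasP; exists k => //; apply: sK.
case: ok => ? ? ? ? ? ? ? ? ? pc; split=> //.
- by apply: leq_trans (sb _ _) _.
- by apply: leq_trans (sb _ _) _.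
move=> u v uD vD /(pc u v uD vD)[[h hL vh] [h' hL' vh']].
by split; [exists h | exists h'] => //; apply: sL.
Qed.

Lemma count_predC_filter (P Q : pred H) T :
  count (predC [pred s | ~~ P s && ~~ Q s]) T <= count P T + count Q T.
Proof.
rewrite -count_predUI; apply: leq_trans (leq_addr _ _).
by apply: sub_count => s /=; rewrite negb_and !negbK.
Qed.

(** The greedy step.  The factor [q] bounds the proportion of each translate
that may already be used; it depends only on the final precision [m] and on
[K0], so it is the same for all Folner sets to come.  At most 2 / q of the
translate is lost; the point x s of the new piece violates equivariance only if
[s] is in the inner boundary of [T] or [s * k] is one of the lost elements for
some [k] in [K0], so the violations are few compared with the piece.  The points
of a piece have x and y for centers, and x s and x t differ by [s^-1 * t]. *)
Lemma add_piece K0 K L m M a b E x y T (w : partial_matching) :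
  let q := 4 * (m * size K0 + m + 1) in
  0 < m -> near_action L a E -> near_action L b E ->
  x \notin E -> y \notin E ->
  {subset K <= L} -> {subset K0 <= L} -> {subset T <= L} ->
  {in T & K, forall s k, (s * k^-1)%g \in L} ->
  {in T &, forall s t, (s^-1 * t)%g \in L} ->
  right_folner (K0 ++ [seq k^-1%g | k <- K]) (2 * m + 2 * M * size K) T ->
  q * count (fun s => a s x \in pm_src w) T <= size T ->
  q * count (fun s => b s y \in pm_tgt w) T <= size T ->
  matching_ok K0 K L m M a b w ->
  exists w', [/\ matching_ok K0 K L m M a b w', pm_src w \subset pm_src w',
    pm_tgt w \subset pm_tgt w' & #|pm_dom w| < #|pm_dom w'|].
Proof.
case: w => D A B p c q m0 na nb xE yE KL K0L TL TKL TTL [uT T0 fT] /= qx qy.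
case=> /= DA pB pinj cD wA wB bA bB vioD pc.
pose T' := [seq s <- T | (a s x \notin A) && (b s y \notin B)].
pose T'' := [seq s <- T | ~~ ((a s x \notin A) && (b s y \notin B))].
have sT'T : {subset T' <= T} by move=> s; rewrite mem_filter => /andP[].
have uT' : uniq T' by rewrite filter_uniq.
have T'TE s : s \in T -> s \notin T' -> s \in T''.
  by move=> sT; rewrite !mem_filter sT !andbT.
have sizeT : size T' + size T'' = size T by rewrite !size_filter count_predC.
have qe : q * size T'' <= 2 * size T.
  have : size T'' <=
      count (fun s => a s x \in A) T + count (fun s => b s y \in B) T.
    by rewrite size_filter; apply: count_predC_filter.
  by move: qx qy; nia.
have cardT' : #|orb a x T'| = size T'.
  by apply: (card_orb na xE) => // s /sT'T/TL.
have T'0 : 0 < size T' by move: qe T0 sizeT; rewrite /q; nia.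
have D'A z : z \in orb a x T' -> z \notin A.
  by case/orbP=> s; rewrite mem_filter => /andP[/andP[sA _] _] ->.
have D'D z : z \in orb a x T' -> z \notin D.
  by move/D'A; apply: contra; apply: (subsetP DA).
have DD' z : z \in D -> z \in orb a x T' = false.
  by move=> zD; apply/negP => /D'D; rewrite zD.
(* g recovers s from the point x s of the new piece. *)
pose g z := nth 1%g T' (index z [seq a s x | s <- T']).
have gE s : s \in T' -> g (a s x) = s.
  move=> sT'; have lt : index (a s x) [seq a s x | s <- T'] < size T'.
    by rewrite -(size_map (fun s => a s x)) index_mem map_f.
  apply: (na x xE).2; rewrite ?TL ?sT'T ?mem_nth //.
  by rewrite -(nth_map _ x (fun s => a s x)) // nth_index ?map_f.
pose s0 := nth 1%g T' 0.
have s0T' : s0 \in T' by rewrite mem_nth.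
pose p' z := if z \in orb a x T' then b (g z) y else p z.
pose c' z := if z \in orb a x T' then a s0 x else c z.
have p'n s : s \in T' -> p' (a s x) = b s y.
  by move=> sT'; rewrite /p' mem_orb // gE.
have c'n s : s \in T' -> c' (a s x) = a s0 x by move=> sT'; rewrite /c' mem_orb.
have p'o z : z \in D -> p' z = p z by move=> zD; rewrite /p' DD'.
have c'o z : z \in D -> c' z = c z by move=> zD; rewrite /c' DD'.
pose D' := D :|: orb a x T'.
have cardD' : #|D'| = #|D| + size T'.
  rewrite -cardT' cardsU (_ : D :&: _ = set0) ?cards0 ?subn0 //.
  by apply/setP => z; rewrite !in_setI in_set0; case zD: (z \in D); rewrite // DD'.
have p'B s : s \in T' -> p' (a s x) \notin B.
  by move=> sT'; rewrite p'n //; move: sT'; rewrite mem_filter => /andP[/andP[]].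
have bd (c0 : H -> {perm X}) z C : near_action L c0 E -> z \notin E ->
    M * #|boundary K c0 C| <= #|D| ->
    M * #|boundary K c0 (C :|: orb c0 z T)| <= #|D'|.
  move=> nc zE leC; rewrite cardD'.
  have := boundary_add C nc zE KL TKL.
  set f := count _ _; set u := #|boundary _ _ _| => leu.
  have le_f : 2 * M * size K * f <= size T.
    apply: leq_trans fT; apply: leq_mul; first by rewrite leq_addl.
    by apply: sub_count => s; apply: contra; rewrite all_cat => /andP[].
  apply: leq_trans (leq_mul (leqnn M) leu) _; rewrite mulnDr leq_add //.
  move: qe sizeT le_f; rewrite /q; set t := size T; set e := size T''.
  move=> h1 h2 h3; have : 4 * e <= t by nia.
  by rewrite mulnA; lia.
exists (PartialMatching D' (A :|: orb a x T) (B :|: orb b y T) p' c').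
split=> /=; rewrite ?subsetUl //; last first.
  by rewrite cardD' -[X in X < _]addn0 ltn_add2l.
split=> /=; rewrite -/D'.
- apply: setUSS => //; apply/subsetP => z /orbP[s sT' ->].
  by rewrite mem_orb ?sT'T.
- move=> z /setUP[zD|/orbP[s sT' ->]]; first by rewrite p'o // inE pB.
  by rewrite p'n // in_setU mem_orb ?orbT ?sT'T.
- move=> u v /setUP[uD|/orbP[s sT' ->]] /setUP[vD|/orbP[t tT' ->]].
  + by rewrite !p'o //; apply: pinj.
  + by rewrite p'o // => uv; case/negP: (p'B _ tT'); rewrite -uv pB.
  + by rewrite [in RHS]p'o // => uv; case/negP: (p'B _ sT'); rewrite uv pB.
  + by rewrite !p'n // => /(nb y yE).2 -> //; rewrite TL ?sT'T.
- move=> z /setUP[zD|/orbP[s sT' ->]]; first by rewrite c'o // inE cD.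
  by rewrite c'n // in_setU mem_orb // orbT.
- have : (A :|: orb a x T) :\: D' \subset (A :\: D) :|: orb a x T''.
    apply/subsetP => z; rewrite in_setD !in_setU negb_or in_setD.
    case/andP=> /andP[zD zT'] /orP[zA|]; first by rewrite zD zA.
    case/orbP=> s sT zE; rewrite zE mem_orb ?orbT //.
    by apply: T'TE => //; apply: contra zT' => sT'; rewrite zE mem_orb.
  move/subset_leq_card/leq_trans/(_ (leq_card_setU _ _)).
  have := card_orb_le a x T''; rewrite cardD'; move: wA qe sizeT; rewrite /q.
  set u := #|_ :\: _|; set v := #|_ :\: _|; set u' := #|orb _ _ _|; nia.
- have : (B :|: orb b y T) :\: p' @: D' \subset (B :\: p @: D) :|: orb b y T''.
    apply/subsetP => z; rewrite in_setD !in_setU in_setD.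
    case/andP=> zD /orP[zB|].
      rewrite zB andbT; apply/orP; left; apply: contra zD => /imsetP[v vD ->].
      by apply/imsetP; exists v; rewrite ?p'o // inE vD.
    case/orbP=> s sT zE; rewrite zE mem_orb ?orbT //.
    apply: T'TE => //; apply: contra zD => sT'; rewrite zE -p'n //.
    by apply: imset_f; rewrite in_setU mem_orb ?orbT.
  move/subset_leq_card/leq_trans/(_ (leq_card_setU _ _)).
  have := card_orb_le b y T''; rewrite cardD'; move: wB qe sizeT; rewrite /q.
  set u := #|_ :\: _|; set v := #|_ :\: _|; set u' := #|orb _ _ _|; nia.
- exact: bd.
- exact: bd.
- rewrite cardD'; pose f := count (broken K0 T) T.
  pose Z1 := orb a x [seq s <- T | broken K0 T s].
  pose Z2 := [set z in [seq a (t * k^-1)%g x | k <- K0, t <- T'']].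
  have leZ1 : #|Z1| <= f by rewrite /f -size_filter card_orb_le.
  have leZ2 : #|Z2| <= size K0 * size T''.
    by rewrite -(size_allpairs (fun k t => a (t * k^-1)%g x)) card_seq_le.
  have : violations K0 a b (PartialMatching D' (A :|: orb a x T)
      (B :|: orb b y T) p' c') \subset
    violations K0 a b (PartialMatching D A B p c) :|: (Z1 :|: Z2).
    apply/subsetP => z; rewrite inE /= => /andP[/setUP[zD|/orbP[s sT' ->{z}]]].
      case/allPn=> k kK0 nk; rewrite in_setU inE /= zD /=; apply/orP; left.
      apply/allPn; exists k => //; apply: contra nk => /and3P[kD pk ck].
      by rewrite in_setU kD !p'o ?c'o // pk ck.
    case/allPn=> k kK0 nk; rewrite !in_setU; apply/orP; right.
    have [skT|skT] := boolP ((s * k)%g \in T); last first.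
      apply/orP; left; apply: mem_orb; rewrite mem_filter sT'T // andbT.
      by apply/allPn; exists k.
    have [skT'|skT'] := boolP ((s * k)%g \in T'); last first.
      apply/orP; right; rewrite inE; apply/allpairsP; exists (k, (s * k)%g).
      by rewrite mulgK T'TE.
    case/negP: nk; have [nax _] := na x xE; have [nby _] := nb y yE.
    have [sL kL] : s \in L /\ k \in L by split; [exact/TL/sT'T | exact: K0L].
    rewrite /= -(nax s k) // in_setU mem_orb // orbT /=.
    by rewrite !p'n // !c'n // (nby s k) // !eqxx.
  move/subset_leq_card/leq_trans/(_ (leq_card_setU _ _)).
  move/leq_trans/(_ (leq_add (leqnn _) (leq_card_setU _ _))).
  have le_f : 2 * m * f <= size T.
    apply: leq_trans fT; apply: leq_mul; first by rewrite leq_addr.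
    by apply: sub_count => s; apply: contra; rewrite all_cat => /andP[].
  move: vioD qe sizeT le_f leZ1 leZ2; rewrite /q.
  set u := #|violations _ _ _ _|; set v := #|violations _ _ _ _|.
  set e := size T''; set t := size T; set t' := size T'.
  set k := size K0; set d := #|D| => h1 h2 h3 h4 h5 h6 h7.
  have h8 : 2 * (m * k * e + m * e + e) <= t by nia.
  have h9 : m * #|Z2| <= m * k * e by rewrite -mulnA leq_mul.
  have h10 : m * #|Z1| <= m * f by rewrite leq_mul.
  apply: leq_trans (leq_mul (leqnn m) h7) _; rewrite !mulnDr; nia.
- move=> u v /setUP[uD|/orbP[s sT' ->]] /setUP[vD|/orbP[t tT' ->]].
  + rewrite !c'o // => /(pc u v uD vD)[[h hL vh] [h' hL' vh']].
    by split; [exists h | exists h'; rewrite ?p'o].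
  + rewrite c'o // c'n // => cu.
    by case/negP: (D'D _ (mem_orb a x s0T')); rewrite -cu cD.
  + rewrite c'n // c'o // => cu.
    by case/negP: (D'D _ (mem_orb a x s0T')); rewrite cu cD.
  move=> _; have stL : (s^-1 * t)%g \in L by rewrite TTL ?sT'T.
  have [nax _] := na x xE; have [nby _] := nb y yE.
  have sL : s \in L by rewrite TL ?sT'T.
  split; exists (s^-1 * t)%g => //; first by rewrite -nax // mulVKg.
  by rewrite !p'n // -nby // mulVKg.
Qed.

(** The domain grows at every greedy step, so the process stops. *)
Lemma saturate_matching K0 K L m M a b E T (w : partial_matching) :
  let q := 4 * (m * size K0 + m + 1) in
  0 < m -> near_action L a E -> near_action L b E ->
  {subset K <= L} -> {subset K0 <= L} -> {subset T <= L} ->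
  {in T & K, forall s k, (s * k^-1)%g \in L} ->
  {in T &, forall s t, (s^-1 * t)%g \in L} ->
  right_folner (K0 ++ [seq k^-1%g | k <- K]) (2 * m + 2 * M * size K) T ->
  matching_ok K0 K L m M a b w ->
  exists w', [/\ matching_ok K0 K L m M a b w', pm_src w \subset pm_src w',
    pm_tgt w \subset pm_tgt w' &
    (forall x, x \notin E -> size T < q * count (fun s => a s x \in pm_src w') T) \/
    (forall y, y \notin E -> size T < q * count (fun s => b s y \in pm_tgt w') T)].
Proof.
move=> q m0 na nb KL K0L TL TKL TTL fT.
have [r] := ubnP (#|X| - #|pm_dom w|); elim: r w => // r IHr w ltr ok.
pose adm (c : H -> {perm X}) (C : {set X}) z :=
  (z \notin E) && (q * count (fun s => c s z \in C) T <= size T).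
have [/existsP[x /andP[xE qx]]|noX] :=
  boolP [exists x, adm a (pm_src w) x]; last first.
  exists w; split=> //; left=> x xE; move/existsPn: noX => /(_ x).
  by rewrite /adm xE /= -ltnNge.
have [/existsP[y /andP[yE qy]]|noY] :=
  boolP [exists y, adm b (pm_tgt w) y]; last first.
  exists w; split=> //; right=> y yE; move/existsPn: noY => /(_ y).
  by rewrite /adm yE /= -ltnNge.
have [w1 [ok1 sA sB ltD]] :=
  add_piece m0 na nb xE yE KL K0L TL TKL TTL fT qx qy ok.
have [|w' [ok' sA' sB' sat]] := IHr w1 _ ok1.
  by have : #|pm_dom w1| <= #|X| := max_card _; move: ltD ltr; lia.
by exists w'; split=> //; [apply: subset_trans sA' | apply: subset_trans sB'].
Qed.

(** Count the pairs (x, s) with x s in [A] but not in [A0].  A point x outside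
[A0], its boundary and [E] has no translate x s in [A0], hence lies in at least
[size T / q] such pairs; a given s occurs in as many pairs as there are points
in [A :\: A0]. *)
Lemma saturated_growth a E T (A0 A : {set X}) q : A0 \subset A ->
  0 < size T ->
  (forall x, x \notin E -> size T < q * count (fun s => a s x \in A) T) ->
  #|X| <= #|A0| + #|boundary T a A0| + #|E| + q * #|A :\: A0|.
Proof.
move=> sA T0 sat; pose Y := ~: (A0 :|: boundary T a A0 :|: E).
have leY : #|Y| * size T <= q * (size T * #|A :\: A0|).
  have <- : \sum_(x in Y) size T = #|Y| * size T by rewrite sum_nat_const.
  apply: (@leq_trans (\sum_(x in Y) q * \sum_(s <- T) (a s x \in A :\: A0))).
    apply: leq_sum => x; rewrite !inE !negb_or negb_and => /andP[/andP[xA0 +] xE].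
    rewrite xA0 /= => /hasPn xT; apply: leq_trans (ltnW (sat x xE)) _.
    rewrite leq_mul // -sum1_count big_mkcond big_seq [X in _ <= X]big_seq.
    by apply: leq_sum => s sT; rewrite in_setD (xT s sT) /=; case: ifP.
  rewrite -big_distrr /= leq_mul //.
  apply: (@leq_trans (\sum_x \sum_(s <- T) (a s x \in A :\: A0))).
    by rewrite [X in _ <= X](bigID (mem Y)) /= leq_addr.
  rewrite exchange_big /=.
  have -> : \sum_(s <- T) \sum_x (a s x \in A :\: A0) = \sum_(s <- T) #|A :\: A0|.
    apply: eq_bigr => s _; rewrite -(card_preim_perm (a s)) -sum1dep_card.
    by rewrite [RHS]big_mkcond; apply: eq_bigr => x _; case: ifP => // ->.
  by rewrite big_const_seq count_predT iter_addn_0 mulnC.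
have {}leY : #|Y| <= q * #|A :\: A0| by rewrite -(leq_pmul2r T0); nia.
have : #|~: Y| <= #|A0| + #|boundary T a A0| + #|E|.
  rewrite setCK; apply: leq_trans (leq_card_setU _ _) _.
  by rewrite leq_add2r leq_card_setU.
by have := cardsC Y; lia.
Qed.

End TwoSides.

(** Folner's condition for right translations, on duplicate-free sequences. *)
Definition right_amenable := forall K m, exists T, right_folner K m T.

Lemma near_actionW (X : finType) L L' (a : H -> {perm X}) E :
  {subset L' <= L} -> near_action L a E -> near_action L' a E.
Proof.
move=> sL na x /(na x)[act inj]; split=> h k /sL hL /sL kL; first exact: act.
exact: inj.
Qed.

(** Unless a side is exhausted, every Folner set adds [#|X| / (2 * q ^ 2)]
points to [pm_src] or to [pm_tgt].  The Folner set used last is chosen first: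
the induction hypothesis is then applied with [K] enlarged by it and [M]
increased, so that what was matched earlier has a small boundary with respect to
it. *)
Lemma exists_large_matching K0 m : right_amenable -> 0 < m ->
  let q := 4 * (m * size K0 + m + 1) in
  forall j K M, exists L N,
    forall (X : finType) (a b : H -> {perm X}) (E : {set X}),
    N * #|E| <= #|X| -> near_action L a E -> near_action L b E ->
    exists2 w, matching_ok K0 K L m M a b w &
      [\/ q * (#|X| - #|pm_src w|) <= #|X|, q * (#|X| - #|pm_tgt w|) <= #|X|
        | j * #|X| <= 2 * q ^ 2 * (#|pm_src w| + #|pm_tgt w|)].
Proof.
move=> amen m0 q; elim=> [|j IHj] K M.
  exists [::], 0 => X a b E _ _ _.
  exists (PartialMatching set0 set0 set0 id id); last first.
    by apply: Or33; rewrite mul0n.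
  have bd0 (c : H -> {perm X}) : #|boundary K c set0| = 0.
    by apply: eq_card0 => z; rewrite !inE; apply/negP => /hasP[k _]; rewrite inE.
  split=> //=; rewrite ?imset0 ?setD0 ?cards0 ?bd0 ?muln0 //;
    try by move=> u; rewrite inE.
  rewrite (_ : violations _ _ _ _ = set0) ?cards0 ?muln0 //.
  by apply/setP => x; rewrite !inE.
have [T fT] := amen (K0 ++ [seq k^-1%g | k <- K]) (2 * m + 2 * M * size K).
have [L1 [N1 IH]] := IHj (K ++ T) (M + 4 * q).
pose L := L1 ++ K ++ K0 ++ T ++ [seq (s * k^-1)%g | s <- T, k <- K]
  ++ [seq (s^-1 * t)%g | s <- T, t <- T].
have sub1 : {subset L1 <= L} by move=> h hL; rewrite !mem_cat hL.
exists L, (N1 + 4 * q) => X a b E leE na nb.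
have [|w0 ok0 cases] := IH X a b E _ (near_actionW sub1 na) (near_actionW sub1 nb).
  by move: leE; nia.
have okw0 : matching_ok K0 K L m M a b w0.
  apply: matching_ok_weaken ok0 _ sub1 _; last by rewrite leq_addr.
  by move=> k kK; rewrite mem_cat kK.
case: cases => [d|d|cases]; first by exists w0 => //; apply: Or31.
  by exists w0 => //; apply: Or32.
have [] := saturate_matching m0 na nb _ _ _ _ _ fT okw0.
- by move=> h hK; rewrite !mem_cat hK ?orbT.
- by move=> h hK; rewrite !mem_cat hK ?orbT.
- by move=> h hK; rewrite !mem_cat hK ?orbT.
- move=> s k sT kK; rewrite !mem_cat.
  by have -> := allpairs_f (fun s k => (s * k^-1)%g) sT kK; rewrite ?orbT.
- move=> s k sT kK; rewrite !mem_cat.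
  by have -> := allpairs_f (fun s t => (s^-1 * t)%g) sT kK; rewrite ?orbT.
move=> w [ok sA sB sat]; exists w => //.
have leD : #|pm_dom w0| <= #|X| := max_card _.
have [_ T0 _] := fT.
(* One side: either it is exhausted, or it gained a fixed fraction of X. *)
have grow (c : H -> {perm X}) (A0 A : {set X}) : A0 \subset A ->
    (M + 4 * q) * #|boundary (K ++ T) c A0| <= #|pm_dom w0| ->
    (forall x, x \notin E -> size T < q * count (fun s => c s x \in A) T) ->
    q * (#|X| - #|A|) <= #|X| \/ #|X| + 2 * q ^ 2 * #|A0| <= 2 * q ^ 2 * #|A|.
  move=> sA0 bd satA; have := saturated_growth sA0 T0 satA.
  have leb : #|boundary T c A0| <= #|boundary (K ++ T) c A0|.
    apply/subset_leq_card/subsetP => z; rewrite !inE has_cat.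
    by case/andP=> -> ->; rewrite orbT.
  have leA : #|A| <= #|X| := max_card _.
  have := cardsD A A0; rewrite (setIidPr sA0) => ->.
  have := subset_leq_card sA0; move: bd leE leb leD leA.
  have q0 : 0 < q by rewrite /q; lia.
  move: q0; generalize q => p p0.
  set n := #|X|; set al := #|A|; set al0 := #|A0|; set e := #|E|.
  set be := #|boundary T c A0|; set be' := #|boundary _ c A0|; set d := #|_|.
  move=> h1 h2 h3 h4 h5 h6 h7.
  have [le|gt] := leqP (p * (n - al)) n; [by left | right].
  have h8 : 4 * (p * be) <= n by nia.
  have h9 : 4 * (p * e) <= n by nia.
  have h10 : n < p * (n - al0) by nia.
  have h11 : p * (n - al0) <= p * be + p * e + p * (p * (al - al0)).
    by rewrite -!mulnDr leq_mul //; lia.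
  have h12 : p ^ 2 * (al - al0) + p ^ 2 * al0 = p ^ 2 * al by rewrite -mulnDr subnK.
  by rewrite expnS expn1 in h12 *; rewrite -!mulnA in h12 *; lia.
have leA : #|pm_src w0| <= #|pm_src w| by apply: subset_leq_card.
have leB : #|pm_tgt w0| <= #|pm_tgt w| by apply: subset_leq_card.
case: sat => sat.
  have [d|g] := grow a _ _ sA (ok_bsrc ok0) sat; [exact: Or31 | apply: Or33].
  by move: cases g; rewrite mulSn !mulnDr; nia.
have [d|g] := grow b _ _ sB (ok_btgt ok0) sat; [exact: Or32 | apply: Or33].
by move: cases g; rewrite mulSn !mulnDr; nia.
Qed.

End Matching.

(** After [4 * q ^ 2 + 1] Folner sets the lower bound for [#|pm_src| +
#|pm_tgt|] exceeds [2 * #|X|], so a side is exhausted; as the domain fills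
almost all of either side, it is almost all of [X].  In the conclusion, [W]
consists of the unmatched points and the points where equivariance fails. *)
Lemma near_conjugacy (H : groupType) (K : seq H) m : right_amenable H ->
  exists L N, forall (X : finType) (a b : H -> {perm X}) (E : {set X}),
    N * #|E| <= #|X| -> near_action L a E -> near_action L b E ->
    exists (sigma : {perm X}) (c : X -> X) (W : {set X}),
    [/\ m * #|W| <= #|X|,
        forall x k, x \notin W -> k \in K ->
          sigma (a k x) = b k (sigma x) /\ c (a k x) = c x
      & forall u v, u \notin W -> v \notin W -> c u = c v ->
          (exists2 h, h \in L & v = a h u) /\
          (exists2 h, h \in L & sigma v = b h (sigma u))].
Proof.
move=> amen; have m1 : 0 < 3 * m + 1 by rewrite addn1.
(* Three defects are to be kept below n / 3 m: the points of the exhausted side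
   not covered, those covered but wasted, and the violations. *)
have := exists_large_matching K amen m1; rewrite /=.
set q := 4 * _ => /(_ (4 * q ^ 2 + 1) [::] 0)[L [N main]].
exists L, N => X a b E leE na nb; have [w ok large] := main X a b E leE na nb.
have [sigma sigmaE] := perm_extension (ok_inj ok).
exists sigma, (pm_lab w), (~: pm_dom w :|: violations K a b w); split.
- have leV : #|~: pm_dom w :|: violations K a b w| <= _ := leq_card_setU _ _.
  have := ok_viol ok; have := ok_wsrc ok; have := ok_wtgt ok.
  set v := #|violations _ _ _ _| in leV *; set d := #|pm_dom w|.
  have : #|~: pm_dom w| + d = #|X| by rewrite addnC cardsC.
  set d' := #|~: _| in leV * => dn.
  have leA : #|pm_src w| <= #|pm_src w :\: pm_dom w| + d.
    by rewrite -(cardsID (pm_dom w)) addnC leq_add2l subset_leq_card ?subsetIr.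
  have leB : #|pm_tgt w| <= #|pm_tgt w :\: pm_map w @: pm_dom w| + d.
    rewrite -(cardsID (pm_map w @: pm_dom w)) addnC leq_add2l.
    by rewrite -[d](card_in_imset (ok_inj ok)) subset_leq_card ?subsetIr.
  have lnA : #|pm_src w| <= #|X| := max_card _.
  have lnB : #|pm_tgt w| <= #|X| := max_card _.
  have q1 : 4 * (3 * m + 1) <= q by rewrite /q leq_mul //; lia.
  move: large leA leB lnA lnB leV dn q1; generalize q => p.
  set n := #|X|; set al := #|pm_src w|; set be := #|pm_tgt w|.
  set wa := #|_ :\: _|; set wb := #|_ :\: _|; set u := #|_ :|: _|.
  move=> large leA leB lnA lnB leV dn q1 h1 h2 h3.
  have : (3 * m + 1) * u <= (3 * m + 1) * d' + (3 * m + 1) * v.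
    by rewrite -mulnDr leq_mul.
  have leq_r (x : nat) : p * x <= n -> (3 * m + 1) * x <= n.
    by apply: leq_trans; rewrite leq_mul //; lia.
  case: large => [/leq_r h|/leq_r h|h].
  + have : (3 * m + 1) * d' <= (3 * m + 1) * (n - al) + (3 * m + 1) * wa.
      by rewrite -mulnDr leq_mul //; lia.
    by nia.
  + have : (3 * m + 1) * d' <= (3 * m + 1) * (n - be) + (3 * m + 1) * wb.
      by rewrite -mulnDr leq_mul //; lia.
    by nia.
  have : 2 * p ^ 2 * (al + be) <= 2 * p ^ 2 * (n + n) by rewrite leq_mul ?leq_add.
  by have : n = 0 by [nia]; nia.
- move=> x k; rewrite in_setU negb_or inE negbK inE => /andP[xD].
  rewrite xD /= negbK => /allP ok_x /ok_x /and3P[akD /eqP + /eqP ->].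
  by rewrite !sigmaE.
move=> u v; rewrite !in_setU !negb_or !inE !negbK => /andP[uD _] /andP[vD _].
by rewrite !sigmaE //; apply: (ok_piece ok).
Qed.

(** Inversion turns left-invariant sets into right-invariant ones. *)
Lemma monotileable_right_amenable (R : realType) (H : groupType) :
  monotileably_amenable H R -> right_amenable H.
Proof.
move=> mono K m; pose r := m * size K + 1.
have eps0 : (0 < (r%:R : R)^-1)%R by rewrite invr_gt0 ltr0n /r addn1.
have [F _ inv] := mono [fset k in [seq k^-1%g | k <- K]]%fset _ eps0.
move: inv; rewrite /invariant_fset; set KF := fsetD _ _ => inv.
have {}inv : r * #|` KF| < #|` F|.
  by move: inv; rewrite ltr_pdivlMl ?ltr0n ?/r ?addn1 // -natrM ltr_nat.
exists [seq f^-1%g | f <- F]; split.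
- by rewrite map_inj_uniq ?fset_uniq //; apply: invg_inj.
- by rewrite size_map; apply: leq_trans inv.
rewrite size_map -size_filter.
have : size [seq s <- [seq f^-1%g | f <- F] | broken K [seq f^-1%g | f <- F] s]
    <= size [seq (k * u)^-1%g | k <- K, u <- KF].
  apply: uniq_leq_size.
    by rewrite filter_uniq // map_inj_uniq ?fset_uniq //; apply: invg_inj.
  move=> s; rewrite mem_filter => /andP[/allPn[k kK skF] /mapP[f fF sE]].
  apply/allpairsP; exists (k, k^-1 * f)%g; split=> //=; last by rewrite mulVKg.
  rewrite in_fsetD; apply/andP; split.
    apply: contra skF => kf; apply/mapP; exists (k^-1 * f)%g => //.
    by rewrite invgM invgK sE.
  apply/imfset2P; exists k^-1%g; first by rewrite /= in_fset map_f.
  by exists f.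
set c := size _; rewrite size_allpairs -[size KF]/(#|` KF|) => le.
have : m * c <= m * (size K * #|` KF|) by rewrite leq_mul.
by move: inv; rewrite /r -[size F]/(#|` F|) mulnA; lia.
Qed.

(** * From soficity to almost actions *)

Lemma hamming_dist_dis (R : realType) n (s t : 'S_n) :
  hamming_dist R s t = ((dis s t)%:R / n%:R)%R.
Proof.
rewrite /hamming_dist; congr (_%:R / _)%R.
rewrite -[LHS](card_preim_perm s); apply: eq_card => i.
by rewrite !inE permM permK eq_sym.
Qed.

Lemma card_leq_has (I : eqType) (X : finType) (r : seq I) (f : I -> {set X}) e :
  (forall i, i \in r -> #|f i| <= e) ->
  #|[set x | has (fun i => x \in f i) r]| <= size r * e.
Proof.
elim: r => [|i r IHr] le_f.
  by rewrite (_ : [set x | _] = set0) ?cards0 //; apply/setP => x; rewrite !inE.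
rewrite mulSn; apply: leq_trans (_ : #|f i :|: _| <= _); last first.
  apply: leq_trans (leq_card_setU _ _) (leq_add (le_f i (mem_head _ _)) (IHr _)).
  by move=> j jr; rewrite le_f // inE jr orbT.
by apply/subset_leq_card/subsetP => x; rewrite !inE.
Qed.

Lemma nat_scale_lt (R : realType) (N d n : nat) (eps : R) : 0 < n ->
  (eps * N%:R <= 1)%R -> ((d%:R / n%:R)%R < eps)%R -> N * d <= n.
Proof.
move=> n0 epsN; rewrite ltr_pdivrMr ?ltr0n // => lt.
rewrite -(ler_nat R) natrM; have n0' : (0 <= n%:R :> R)%R by rewrite ler0n.
have := ler_wpM2r n0' epsN; have N0 : (0 <= N%:R :> R)%R by rewrite ler0n.
by have := ler_wpM2l N0 (ltW lt); lra.
Qed.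

(** Two different elements g, h of [F] have different images at most points
because [phi (g^-1 * h)] is close to [(phi g)^-1 * phi h] and has few fixed
points. *)
Lemma sofic_near_action (R : realType) (G : groupType) (F : seq G) (N : nat) :
  sofic R G -> exists n (phi : G -> 'S_n) (E : {set 'I_n}),
    [/\ 0 < n, N * #|E| <= n & near_action F phi E].
Proof.
move=> sofG; pose pairs := [seq (g, h) | g <- F, h <- F].
pose F' := [fset g in F ++ [seq (g * h)%g | g <- F, h <- F]
  ++ [seq (g^-1 * h)%g | g <- F, h <- F]]%fset.
pose M := N * size pairs + 1.
have M0 : (0 < M%:R :> R)%R by rewrite ltr0n /M addn1.
(* Each pair contributes three errors of size eps * n. *)
have eps0 : (0 < (4 * M%:R)^-1 :> R)%R by rewrite invr_gt0 mulr_gt0.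
have [n [phi [n0 free mult]]] := sofG F' _ eps0.
have sF g : g \in F -> g \in F' by move=> gF; rewrite in_fset mem_cat gF.
have sM g h : g \in F -> h \in F -> (g * h)%g \in F'.
  move=> gF hF; rewrite in_fset !mem_cat.
  by have -> := allpairs_f (fun g h => (g * h)%g) gF hF; rewrite ?orbT.
have sV g h : g \in F -> h \in F -> (g^-1 * h)%g \in F'.
  move=> gF hF; rewrite in_fset !mem_cat.
  by have -> := allpairs_f (fun g h => (g^-1 * h)%g) gF hF; rewrite ?orbT.
have eps4 : ((4 * M%:R)^-1 * (4 * M)%:R <= 1 :> R)%R.
  by rewrite natrM mulVf // mulf_neq0 ?pnatr_eq0 // /M addn1.
have mult' g h : g \in F' -> h \in F' ->
    4 * M * dis (phi (g^-1 * h)%g) ((phi g)^-1 * phi h)%g <= n.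
  move=> gF hF; apply: (nat_scale_lt n0 eps4).
  by rewrite -hamming_dist_dis mult.
have free' g : g \in F' -> g <> 1%g -> 4 * M * (n - dis (phi g) 1%g) <= n.
  move=> gF g1; apply: (nat_scale_lt n0 eps4).
  have led : dis (phi g) 1%g <= n by rewrite -[n in X in _ <= X]card_ord max_card.
  rewrite natrB // mulrBl divff ?pnatr_eq0 -?lt0n // ltrBlDr -ltrBlDl.
  by rewrite -hamming_dist_dis free.
pose E1 (p : G * G) := [set i | phi (p.1 * p.2)%g i != (phi p.1 * phi p.2)%g i].
pose E2 (p : G * G) :=
  [set i | (p.1 != p.2) && (phi p.1 i == phi p.2 i)].
have leE p : p \in pairs -> 4 * M * #|E1 p :|: E2 p| <= 3 * n.
  case/allpairsP=> -[g h] [/= gF hF ->].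
  have le1 : 4 * M * #|E1 (g, h)| <= n.
    apply: leq_trans (mult' g (g * h)%g (sF g gF) (sM g h gF hF)).
    rewrite leq_mul // mulKg -[X in _ <= X](dis_mull _ _ (phi g)) mulVKg.
    by rewrite dis_sym.
  have le2 : 4 * M * #|E2 (g, h)| <= 2 * n.
    have [->|/eqP gh] := eqVneq g h.
      rewrite (_ : E2 _ = set0) ?cards0 ?muln0 //.
      by apply/setP => i; rewrite !inE eqxx.
    have g1 : (g^-1 * h)%g <> 1%g.
      by move=> gh1; apply: gh; rewrite -[h](mulVKg g) gh1 mulg1.
    have := free' _ (sV g h gF hF) g1; have := mult' g h (sF g gF) (sF h hF).
    have : #|E2 (g, h)| + dis (phi g) (phi h) <= n.
      rewrite -[n in X in _ <= X]card_ord -(cardsC (E2 (g, h))) leq_add2l.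
      apply/subset_leq_card/subsetP => i; rewrite !inE /=.
      by apply: contra => /andP[].
    have := dis_triangle ((phi g)^-1 * phi h)%g 1%g (phi (g^-1 * h)%g).
    have -> : dis 1%g ((phi g)^-1 * phi h)%g = dis (phi g) (phi h).
      by rewrite -(dis_mull _ _ (phi g)) mulg1 mulKVg.
    rewrite (dis_sym 1%g) [dis _ (phi (g^-1 * h)%g)]dis_sym.
    set d1 := dis (_ (g^-1 * h)%g) 1%g; set d2 := dis _ (_ * _)%g.
    move: (4 * M) => c tri le_e le_d2 le_d1.
    have : c * #|E2 (g, h)| <= c * (n - d1) + c * d2.
      by rewrite -mulnDr leq_mul //; lia.
    by lia.
  apply: leq_trans (leq_mul (leqnn _) (leq_card_setU _ _)) _.
  by rewrite mulnDr mulSn leq_add.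
exists n, phi, [set x | has (fun p => x \in E1 p :|: E2 p) pairs]; split=> //.
  have M4 : 0 < 4 * M by rewrite /M addn1.
  have le_e p : p \in pairs -> #|E1 p :|: E2 p| <= (3 * n) %/ (4 * M).
    by move=> /leE; rewrite leq_divRL // mulnC.
  apply: leq_trans (leq_mul (leqnn N) (card_leq_has le_e)) _.
  have := leq_trunc_div (3 * n) (4 * M); move: (_ %/ _) => e.
  rewrite /M [N * (_ * _)]mulnA.
  by move: (N * size pairs) => c; nia.
move=> x xE; have good p : p \in pairs -> x \notin E1 p :|: E2 p.
  by move=> pP; apply: contra xE => xp; rewrite inE; apply/hasP; exists p.
split=> g h gF hF; have := good (g, h) (allpairs_f _ gF hF).
  by rewrite in_setU !inE negb_or negbK permM => /andP[/eqP].
rewrite in_setU !inE negb_or => /andP[_ +] gh.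
by rewrite /= gh eqxx andbT negbK => /eqP.
Qed.

(** * Words in an HNN extension *)

Section HNNWords.
Variables (G : groupType) (S : pred G) (H : subGroupType S).
Variable theta : UMagmaMorphism.type H G.
Local Notation Gamma := (HNN theta).
Local Open Scope quotient_scope.

Lemma hnn_pi_cat u v : \pi_Gamma (u ++ v) = (\pi_Gamma u * \pi_Gamma v)%g.
Proof. by rewrite -[RHS]/(hnn_mul _ _) hnn_mul_pi. Qed.

Lemma hnn_pi_nil : \pi_Gamma [::] = 1%g.
Proof. by []. Qed.

Lemma hnn_pi_stableV : \pi_Gamma [:: inr false] = (hnn_stable theta)^-1%g.
Proof. by rewrite -[RHS]/(hnn_inv _) /hnn_stable hnn_inv_pi. Qed.

(** The elements that can be moved across the letter [inr b], that is, the
middle of a subword that the defining relations shorten. *)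
Definition associated (b : bool) (g : G) : Prop :=
  if b then exists h : H, g = theta h else exists h : H, g = val h.

(** The pair (b, g) stands for the letter [inr b] followed by [g]. *)
Definition nf_tail (s : seq (bool * G)) : hnn_word G :=
  flatten [seq [:: inr p.1; inl p.2] | p <- s].

Definition nf_word (g : G) (s : seq (bool * G)) : hnn_word G :=
  inl g :: nf_tail s.

Definition no_pinch (s : seq (bool * G)) : bool :=
  sorted (fun p p' => ~~ ((p'.1 == ~~ p.1) && `[< associated p.1 p.2 >])) s.

Lemma hnn_pi_nf g s :
  \pi_Gamma (nf_word g s) = (hnn_base theta g * \pi_Gamma (nf_tail s))%g.
Proof. exact: hnn_pi_cat [:: inl g] _. Qed.

Lemma hnn_pi_nf_tail b g s : \pi_Gamma (nf_tail ((b, g) :: s)) =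
  (\pi_Gamma [:: inr b] * (hnn_base theta g * \pi_Gamma (nf_tail s)))%g.
Proof. by rewrite -hnn_pi_nf; exact: hnn_pi_cat [:: inr b] _. Qed.

(** Reading the word from its end, a new letter t^{+-1} either is prepended or
cancels the first one, and the tail of a word without pinches has none. *)
Lemma exists_normal_form (u : hnn_word G) :
  exists g s, hnn_eq theta u (nf_word g s) /\ no_pinch s.
Proof.
elim: u => [|l u [g [s [us red]]]].
  by exists 1%g, [::]; split=> //; apply: HnnSym; apply: HnnOne.
have lu : \pi_Gamma (l :: u) = (\pi_Gamma [:: l] * \pi_Gamma (nf_word g s))%g.
  rewrite -[LHS]/(\pi_Gamma ([:: l] ++ u)) hnn_pi_cat.
  by congr (_ * _)%g; apply/hnn_piP.
case: l lu => [g'|b] lu.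
  exists (g' * g)%g, s; split=> //; apply/hnn_piP.
  by rewrite lu !hnn_pi_nf hnn_baseM mulgA.
have push : hnn_eq theta (inr b :: u) (nf_word 1 ((b, g) :: s)).
  by apply/hnn_piP; rewrite lu !hnn_pi_nf hnn_pi_nf_tail hnn_base1 mul1g.
case: s us red lu push => [|[b' g'] s] us red lu push.
  by exists 1%g, [:: (b, g)].
have [/andP[/= /eqP bb /asboolP as_g]|np] :=
  boolP ((b' == ~~ b) && `[< associated b g >]); last first.
  by exists 1%g, ((b, g) :: (b', g') :: s); split=> //=; rewrite np.
suff [k kE] : exists k : G, (\pi_Gamma [:: inr b] * hnn_base theta g *
    \pi_Gamma [:: inr (~~ b)])%g = hnn_base theta k.
  exists (k * g')%g, s; split; last by move: red => /= /path_sorted.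
  apply/hnn_piP; rewrite lu !hnn_pi_nf hnn_pi_nf_tail bb.
  by rewrite hnn_baseM -kE !mulgA.
case: b as_g {push lu bb} => -[h ->] /=.
  exists (val h); rewrite hnn_pi_stableV -hnn_relation.
  by rewrite -/(hnn_stable theta) !mulgA mulgV mul1g mulgK.
exists (theta h); rewrite hnn_pi_stableV; exact: hnn_relation.
Qed.

Section Evaluation.
Variables (Y : finType) (phi : G -> {perm Y}) (tau : {perm Y}).

Definition ev_letter (l : G + bool) : {perm Y} :=
  match l with inl g => phi g | inr b => if b then tau else (tau^-1)%g end.

Definition ev_word (u : hnn_word G) : {perm Y} := (\prod_(l <- u) ev_letter l)%g.

Lemma ev_word_cat u v : ev_word (u ++ v) = (ev_word u * ev_word v)%g.
Proof. by rewrite /ev_word big_cat. Qed.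

(** Only the relations indexed by [F] and [K] are asked for, as a derivation of
an equality between words uses finitely many. *)
Definition near_hnn (F : seq G) (K : seq H) (e : nat) : Prop :=
  [/\ dis (phi 1%g) 1%g <= e,
      {in F &, forall g g', dis (phi (g * g')%g) (phi g * phi g')%g <= e}
    & {in K, forall h,
        dis (tau^-1 * phi (val h) * tau)%g (phi (theta h)) <= e}].

End Evaluation.

Lemma near_hnnW Y (phi : G -> {perm Y}) tau F F' K K' e :
  {subset F' <= F} -> {subset K' <= K} ->
  near_hnn phi tau F K e -> near_hnn phi tau F' K' e.
Proof.
move=> sF sK [one mul rel]; split=> // [g g' /sF gF /sF g'F|h /sK hK].
  exact: mul.
exact: rel.
Qed.

Definition stably_equal (u v : hnn_word G) (F : seq G) (K : seq H) (N : nat) :=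
  forall (Y : finType) (phi : G -> {perm Y}) tau e,
    near_hnn phi tau F K e -> dis (ev_word phi tau u) (ev_word phi tau v) <= N * e.

(** The Hamming distance is invariant under left and right translations, so the
errors made at the steps of a derivation add up. *)
Lemma hnn_eq_stably_equal u v : hnn_eq theta u v ->
  exists F K N, stably_equal u v F K N.
Proof.
elim=> {u v}.
- by move=> u; exists [::], [::], 0 => Y phi tau e _; rewrite dis_eq.
- move=> u v _ [F [K [N uv]]]; exists F, K, N => Y phi tau e near.
  by rewrite dis_sym; apply: uv.
- move=> u v w _ [F [K [N uv]]] _ [F' [K' [N' vw]]].
  exists (F ++ F'), (K ++ K'), (N + N') => Y phi tau e near.
  apply: leq_trans (dis_triangle (ev_word phi tau v) _ _) _.
  rewrite mulnDl leq_add //.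
    by apply: uv; apply: near_hnnW near => x xin; rewrite mem_cat xin.
  by apply: vw; apply: near_hnnW near => x xin; rewrite mem_cat xin orbT.
- move=> u u' v v' _ [F [K [N uu]]] _ [F' [K' [N' vv]]].
  exists (F ++ F'), (K ++ K'), (N + N') => Y phi tau e near.
  rewrite !ev_word_cat.
  apply: leq_trans (dis_triangle (ev_word phi tau u' * ev_word phi tau v)%g _ _) _.
  rewrite dis_mulr dis_mull mulnDl leq_add //.
    by apply: uu; apply: near_hnnW near => x xin; rewrite mem_cat xin.
  by apply: vv; apply: near_hnnW near => x xin; rewrite mem_cat xin orbT.
- exists [::], [::], 1 => Y phi tau e [one _ _].
  by rewrite /ev_word big_seq1 big_nil mul1n.
- move=> g g'; exists [:: g; g'], [::], 1 => Y phi tau e [_ mul _].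
  rewrite /ev_word big_cons !big_seq1 /= dis_sym mul1n.
  by apply: mul; rewrite !inE eqxx ?orbT.
- move=> b; exists [::], [::], 0 => Y phi tau e _.
  rewrite dis_eq // /ev_word big_cons big_seq1 big_nil.
  by case: b; rewrite /= ?mulgV ?mulVg.
move=> h; exists [::], [:: h], 1 => Y phi tau e [_ _ rel].
by rewrite /ev_word !big_cons !big_nil /= !mulg1 mulgA mul1n rel ?inE.
Qed.

Lemma hnn_eqs_stably_equal (r : seq (hnn_word G * hnn_word G)) :
  (forall p, p \in r -> hnn_eq theta p.1 p.2) ->
  exists F K N, forall p, p \in r -> stably_equal p.1 p.2 F K N.
Proof.
elim: r => [|[u v] r IHr] eqr; first by exists [::], [::], 0.
have [|F [K [N rP]]] := IHr; first by move=> p pr; apply: eqr; rewrite inE pr orbT.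
have [F' [K' [N' uv]]] := hnn_eq_stably_equal (eqr _ (mem_head _ _)).
exists (F ++ F'), (K ++ K'), (N + N') => p.
rewrite inE => /predU1P[->|pr] Y phi tau e near; rewrite mulnDl.
  apply: leq_trans (leq_addl _ _); apply: uv.
  by apply: near_hnnW near => x xin; rewrite mem_cat xin orbT.
apply: leq_trans (leq_addr _ _); apply: rP => //.
by apply: near_hnnW near => x xin; rewrite mem_cat xin.
Qed.

End HNNWords.

(** * Skew products and their fixed points *)

Section SkewProduct.
Variables X B : finType.
Implicit Types (p : {perm X}) (f : X -> {perm B}).

(** The second factor is the group [{perm B}] acting on itself rather than [B]:
a product of values of [f] other than 1 then has no fixed point at all. *)
Definition skew_fun p f (z : X * {perm B}) := (p z.1, (z.2 * f z.1)%g).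

Lemma skew_inj p f : injective (skew_fun p f).
Proof. by case=> [x g] [x' g'] [/perm_inj <- /mulIg <-]. Qed.

Definition skew p f : {perm X * {perm B}} := perm (@skew_inj p f).

Lemma skewE p f x g : skew p f (x, g) = (p x, (g * f x)%g).
Proof. by rewrite permE. Qed.

Lemma skewVE p f x g : (skew p f)^-1%g (x, g) =
  (p^-1%g x, (g * (f (p^-1%g x))^-1)%g).
Proof. by apply: (@perm_inj _ (skew p f)); rewrite permKV skewE permKV mulgKV. Qed.

Lemma dis_slice (s t : {perm X * {perm B}}) (E : {set X}) :
  (forall x g, x \notin E -> s (x, g) = t (x, g)) ->
  dis s t <= #|E| * #|{perm B}|.
Proof.
move=> st; rewrite -[X in _ <= _ * X]cardsT -cardsX; apply: dis_le => -[x g].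
by rewrite !inE andbT; apply: st.
Qed.

End SkewProduct.

Section HNNFree.
Variables (G : groupType) (S : pred G) (H : subGroupType S).
Variable theta : UMagmaMorphism.type H G.
Variables (X B : finType) (phi : G -> {perm X}) (sigma : {perm X}).
Variables (c : X -> X) (q : X -> {perm B}).

Let sg (b : bool) : {perm X} := if b then sigma else sigma^-1%g.
Let base g := skew (phi g) (fun _ => 1 : {perm B})%g.
Let stable := skew sigma (q \o c).

(** The pieces met when the word [nf_tail s] is read from the point [u].  A
letter t^-1 uses the label of the point it arrives at, because it undoes a t
that starts there. *)
Fixpoint labels (u : X) (s : seq (bool * G)) : seq (X * bool) :=
  if s is (b, g) :: s' then
    (c (if b then u else sigma^-1%g u), b) :: labels (phi g (sg b u)) s'
  else [::].

Fixpoint endpoint (u : X) (s : seq (bool * G)) : X :=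
  if s is (b, g) :: s' then endpoint (phi g (sg b u)) s' else u.

Lemma size_labels u s : size (labels u s) = size s.
Proof. by elim: s u => //= -[b g] s IHs u /=; rewrite IHs. Qed.

Lemma stableE b u z : ev_letter base stable (inr b) (u, z) =
  (sg b u, (z * if b then q (c u) else (q (c (sigma^-1%g u)))^-1)%g).
Proof. by case: b; rewrite /= /stable ?skewVE ?skewE. Qed.

Lemma baseE g u z : base g (u, z) = (phi g u, z).
Proof. by rewrite /base skewE mulg1. Qed.

Lemma ev_nf_tail s u z : ev_word base stable (nf_tail s) (u, z) =
  (endpoint u s, (z * perm_word q (labels u s))%g).
Proof.
elim: s u z => [|[b g] s IHs] u z.
  by rewrite /ev_word /perm_word !big_nil perm1 mulg1.
rewrite -[nf_tail _]/([:: inr b; inl g] ++ nf_tail s) ev_word_cat permM.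
rewrite [ev_word _ _ [:: _; _]]big_cons big_seq1 permM stableE.
rewrite [ev_letter _ _ (inl g) _]baseE IHs.
by rewrite /perm_word big_cons mulgA; case: b.
Qed.

Variable (Z : {set X}).

Fixpoint clean (u : X) (s : seq (bool * G)) : bool :=
  if s is (b, g) :: s' then
    [&& u \notin Z, sg b u \notin Z & clean (phi g (sg b u)) s']
  else true.

Lemma card_unclean s : #|[set u | ~~ clean u s]| <= 2 * size s * #|Z|.
Proof.
elim: s => [|[b g] s IHs].
  by rewrite (_ : [set u | _] = set0) ?cards0 //; apply/setP => u; rewrite !inE.
have -> : [set u | ~~ clean u ((b, g) :: s)] = Z :|: [set u | sg b u \in Z]
    :|: [set u | (sg b * phi g)%g u \in [set u | ~~ clean u s]].
  by apply/setP => u; rewrite !inE /= permM !negb_and !negbK orbA.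
apply: leq_trans (leq_card_setU _ _) _; rewrite card_preim_perm.
apply: leq_trans (leq_add (leq_card_setU _ _) IHs) _.
by rewrite card_preim_perm /=; lia.
Qed.

Variables (F : seq G) (L : seq H) (W : {set X}).
Hypothesis phi_act : near_action F phi Z.
Hypothesis valL : {in L, forall h, val h \in F}.
Hypothesis thetaL : {in L, forall h, theta h \in F}.
Hypothesis ZW : forall x, x \notin Z -> (x \notin W) && (sigma^-1%g x \notin W).
Hypothesis pieces : forall u v, u \notin W -> v \notin W -> c u = c v ->
  (exists2 h, h \in L & v = phi (val h) u) /\
  (exists2 h, h \in L & sigma v = phi (theta h) (sigma u)).

(** If two consecutive labels cancel, the base letter [g] between them maps a
point to a point of the same piece (or of the [sigma]-image of the same piece).
So does an element of the associated subgroup, and freeness of [phi] identifies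
the two: this is a pinch. *)
Lemma labels_freely_reduced u s : clean u s -> no_pinch theta s ->
  {subset [seq p.2 | p <- s] <= F} -> freely_reduced (labels u s).
Proof.
elim: s u => // -[b g] s IHs u /= /and3P[uZ suZ cl] red sF.
have {IHs} IH : freely_reduced (labels (phi g (sg b u)) s).
  apply: IHs => //; first exact: path_sorted red.
  by move=> x xs; apply: sF; rewrite inE xs orbT.
case: s red cl IH sF => [|[b' g'] s] //= /andP[np _] /and3P[vZ _ _] IH sF.
have gF : g \in F by apply: sF; rewrite mem_head.
rewrite /freely_reduced /= IH andbT {IH}; apply: contra np => /eqP[+ b'E].
rewrite {}b'E eqxx => cc; apply/asboolP; have [uW su_W] := andP (ZW uZ).
have [vW sv_W] := andP (ZW vZ); have [_ inj] := phi_act suZ.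
case: b suZ cc vZ vW sv_W inj => /= suZ cc vZ vW sv_W inj.
  have [_ [h hL]] := pieces uW sv_W (esym cc); rewrite permKV => vE.
  by exists h; apply: inj => //; apply: thetaL.
have [[h hL vE] _] := pieces su_W vW (esym cc).
by exists h; apply: inj => //; apply: valL.
Qed.

Variable k : nat.
Hypothesis q_free : forall s, 0 < size s <= k -> freely_reduced s ->
  perm_word q s != 1%g.

Lemma fixed_points_nf g s : g \in F -> {subset [seq p.2 | p <- s] <= F} ->
  1%g \in F -> no_pinch theta s -> size s <= k -> (s = [::] -> g <> 1%g) ->
  #|[set x | ev_word base stable (nf_word g s) x == x]| <=
    (2 * k + 1) * (#|Z| * #|{perm B}|).
Proof.
move=> gF sF F1 red sk g1; pose U := [set x | ~~ clean (phi g x) s] :|: Z.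
have leU : #|U| <= (2 * k + 1) * #|Z|.
  apply: leq_trans (leq_card_setU _ _) _.
  have -> : [set x | ~~ clean (phi g x) s]
      = [set x | phi g x \in [set u | ~~ clean u s]].
    by apply/setP => x; rewrite !inE.
  rewrite card_preim_perm; have := card_unclean s; set d := #|_|; set e := #|Z|.
  move=> le; apply: leq_trans (leq_add le (leqnn e)) _.
  by rewrite mulnDl mul1n leq_add2r leq_mul // leq_mul.
rewrite mulnA; apply: leq_trans (leq_mul leU (leqnn _)).
rewrite -[X in _ <= _ * X]cardsT -cardsX; apply/subset_leq_card/subsetP => -[x z].
rewrite inE in_setX in_setT andbT -[nf_word g s]/([:: inl g] ++ nf_tail s).
rewrite ev_word_cat permM [ev_word _ _ [:: _]]big_seq1 [ev_letter _ _ _ _]baseE.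
rewrite ev_nf_tail; apply: contraLR; rewrite !inE negb_or negbK => /andP[cl xZ].
apply/eqP => -[xE zE] {U leU}; case: s => [|p s] in g1 sF red sk cl xE zE *.
  apply: g1 => //; have [mul inj] := phi_act xZ; apply: inj => //.
  rewrite [phi g x]xE; apply: (@perm_inj _ (phi 1%g)).
  by rewrite -mul // mulg1.
have sl : 0 < size (labels (phi g x) (p :: s)) <= k by rewrite size_labels.
have /eqP[] := q_free sl (labels_freely_reduced cl red sF).
by apply: (mulgI z); rewrite zE mulg1.
Qed.

End HNNFree.

(** * Soficity of the extension *)

Section Numbering.
Variable Y : finType.

Lemma rank_fun_inj (s : {perm Y}) :
  injective (fun i : 'I_#|Y| => enum_rank (s (enum_val i))).
Proof. by move=> i j /enum_rank_inj/perm_inj/enum_val_inj. Qed.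

Definition rank_perm (s : {perm Y}) : 'S_#|Y| := perm (@rank_fun_inj s).

Lemma rank_permM s t : rank_perm (s * t)%g = (rank_perm s * rank_perm t)%g.
Proof. by apply/permP => i; rewrite !permE /= !permE enum_rankK. Qed.

Lemma rank_perm1 : rank_perm 1%g = 1%g.
Proof. by apply/permP => i; rewrite permE !perm1 enum_valK. Qed.

Lemma dis_rank_perm s t : dis (rank_perm s) (rank_perm t) = dis s t.
Proof.
rewrite -[RHS](card_imset _ enum_rank_inj); apply: eq_card => i.
rewrite -[i in RHS]enum_valK (mem_imset _ _ enum_rank_inj) !inE !permE.
by rewrite (inj_eq enum_rank_inj).
Qed.

End Numbering.

(** Numbering the points of [Y] and choosing [m] larger than the inverse of the
precision turns these counts into normalized Hamming distances. *)
Lemma sofic_of_perms (R : realType) (G : groupType) :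
  (forall (F : {fset G}) (m : nat), exists (Y : finType) (Psi : G -> {perm Y}),
    [/\ 0 < #|Y|,
      forall g, g \in F -> g <> 1%g -> m * (#|Y| - dis (Psi g) 1%g) <= #|Y|
    & forall g1 g2, g1 \in F -> g2 \in F ->
        m * dis (Psi g1 * Psi (g1^-1 * g2))%g (Psi g2) <= #|Y|]) ->
  sofic R G.
Proof.
move=> approx F eps eps0; pose m := Num.bound eps^-1%R.
have m_gt : (1 < eps * m%:R)%R.
  rewrite -ltr_pdivrMl // mulr1; apply: archi_boundP.
  by rewrite invr_ge0 ltW.
have [Y [Psi [Y0 free mult]]] := approx F m.
have Y0R : (0 < #|Y|%:R :> R)%R by rewrite ltr0n.
have small d : m * d <= #|Y| -> (d%:R < eps * #|Y|%:R)%R.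
  have [->|d0] := posnP d; first by rewrite mulr_gt0.
  rewrite -(ler_nat R) natrM => le_d; have d0R : (0 < d%:R :> R)%R by rewrite ltr0n.
  have := ler_wpM2l (ltW eps0) le_d; apply: lt_le_trans.
  by rewrite mulrA -[X in (X < _)%R]mul1r ltr_pM2r.
exists #|Y|, (fun g => rank_perm (Psi g)); split=> // [g gF g1|g1 g2 g1F g2F].
  rewrite hamming_dist_dis -rank_perm1 dis_rank_perm ltr_pdivlMr //.
  have le : dis (Psi g) 1%g <= #|Y| := max_card _.
  by have := small _ (free g gF g1); rewrite natrB //; lra.
rewrite hamming_dist_dis ltr_pdivrMr //; apply: small.
rewrite -(dis_mull _ _ (rank_perm (Psi g1))) mulKVg -rank_permM dis_rank_perm.
exact: mult.
Qed.

Theorem corollary3p6 (R : realType) (G : groupType) (S : pred G)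
    (H : subGroupType S) (theta : UMagmaMorphism.type H G) :
  sofic R G -> monotileably_amenable H R -> injective theta ->
  sofic R (HNN theta).
Proof.
move=> sofG mono theta_inj; apply: sofic_of_perms => F m.
pose nf_of (x : HNN theta) p :=
  hnn_eq theta (repr x) (nf_word p.1 p.2) /\ no_pinch theta p.2.
have /boolp.choice[nf nfP] : forall x, exists p, nf_of x p.
  move=> x.
  by have [g [s ?]] := exists_normal_form theta (repr x); exists (g, s).
pose mults := [seq (repr x ++ repr (x^-1 * y : HNN theta)%g, repr y) |
  x : HNN theta <- F, y : HNN theta <- F].
pose nfs := [seq (repr x, nf_word (nf x).1 (nf x).2) | x : HNN theta <- F].
have [|F1 [K [N stab]]] := @hnn_eqs_stably_equal _ _ _ theta (mults ++ nfs).
  move=> p; rewrite mem_cat => /orP[/allpairsP[[x y] [_ _ ->]]|/mapP[x _ ->]] /=.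
    by apply/hnn_piP; rewrite hnn_pi_cat !reprK mulVKg.
  by have [] := nfP x.
pose k := \max_(x <- F) size (nf x).2.
(* N errors come from the relations, 2 k + 1 from the path of a normal form. *)
pose T := N + (2 * k + 1).
have amen := monotileable_right_amenable mono.
have [L [M conj]] := near_conjugacy K (4 * m * T) amen.
pose letters := flatten [seq (nf x).1 :: [seq p.2 | p <- (nf x).2] | x <- F].
pose F2 := 1%g :: F1 ++ letters ++ [seq val h | h <- L] ++ [seq theta h | h <- L].
have [n [phi [E [n0 leE act]]]] := sofic_near_action F2 (M + 2 * m * T) sofG.
have valL : {in L, forall h, val h \in F2}.
  by move=> h hL; rewrite inE !mem_cat (map_f val hL) ?orbT.
have thetaL : {in L, forall h, theta h \in F2}.
  by move=> h hL; rewrite inE !mem_cat (map_f theta hL) ?orbT.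
have actH (f : UMagmaMorphism.type H G) :
    injective f -> {in L, forall h, f h \in F2} ->
    near_action L (fun h => phi (f h)) E.
  move=> f_inj fL x /act[mul inj]; split=> h h' hL h'L.
    by rewrite gmulfM mul ?fL.
  by move=> /inj/f_inj -> //; apply: fL.
have [|sigma [c [W [leW equiv pieces]]]] := conj 'I_n _ _ E _
    (actH (val : UMagmaMorphism.type H G) val_inj valL)
    (actH theta theta_inj thetaL).
  by rewrite card_ord; apply: leq_trans leE; rewrite leq_mul // leq_addr.
rewrite card_ord in leW.
have [B [q q_free]] := exists_free_perms 'I_n k.
(* A letter t^-1 at x requires sigma^-1 x to be good. *)
pose Z := E :|: W :|: [set x | sigma^-1%g x \in W].
have leZ : m * (T * #|Z|) <= n.
  have : #|Z| <= #|E| + #|W| + #|W|.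
    apply: leq_trans (leq_card_setU _ _) (leq_add (leq_card_setU _ _) _).
    by rewrite card_preim_perm.
  move=> le; have : m * T * #|Z| <= m * T * (#|E| + #|W| + #|W|) by rewrite leq_mul.
  move: leE leW; rewrite [m * (T * _)]mulnA -[4 * m * T]mulnA -[2 * m * T]mulnA.
  by move: (m * T) => d; nia.
pose base g := skew (phi g) (fun _ => 1 : {perm B})%g.
pose stable := skew sigma (q \o c).
pose e := #|Z| * #|{perm B}|.
have Y0 : 0 < #|{: 'I_n * {perm B}}|.
  by rewrite card_prod card_ord muln_gt0 n0; apply/card_gt0P; exists 1%g.
have leT d : d <= T * e -> m * d <= #|{: 'I_n * {perm B}}|.
  move=> le; apply: leq_trans (leq_mul (leqnn m) le) _.
  by rewrite card_prod card_ord /e [T * _]mulnA mulnA leq_mul.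
have near : near_hnn theta base stable F1 K e.
  have actZ x : x \notin Z -> x \notin E.
    by rewrite !in_setU !negb_or => /andP[/andP[]].
  split.
  - apply: dis_slice => x z /actZ/act[mul _]; rewrite skewE mulg1 perm1.
    congr (_, _); apply: (@perm_inj _ (phi 1%g)).
    by rewrite -mul ?mulg1 // mem_head.
  - move=> g g' gF g'F; apply: dis_slice => x z /actZ/act[mul _].
    by rewrite permM !skewE !mulg1 mul // inE mem_cat ?gF ?g'F ?orbT.
  - move=> h hK; apply: dis_slice => x z; rewrite !in_setU !negb_or inE.
    case/andP=> _ /(equiv _ h)/(_ hK)[sE cE].
    by rewrite !permM skewVE !skewE /= sE cE permKV mulg1 mulgVK ?mulg1.
exists ('I_n * {perm B})%type, (fun x => ev_word base stable (repr x)); split=> //.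
  move=> x xF x1; apply: leT; have [xnf red] := nfP x.
  have lettersF : {subset (nf x).1 :: [seq p.2 | p <- (nf x).2] <= F2}.
    move=> g gx; rewrite inE !mem_cat [g \in letters](_ : _ = true) ?orbT //.
    by apply/flatten_mapP; exists x.
  have sF : {subset [seq p.2 | p <- (nf x).2] <= F2}.
    by move=> g gs; rewrite lettersF // inE gs orbT.
  pose w := ev_word base stable (nf_word (nf x).1 (nf x).2).
  have near_w : dis (ev_word base stable (repr x)) w <= N * e.
    apply: (stab (repr x, nf_word (nf x).1 (nf x).2)) near.
    by rewrite mem_cat; apply/orP; right; apply/mapP; exists x.
  have fix_w : #|[set y | w y == y]| <= (2 * k + 1) * e.
    apply: (@fixed_points_nf _ _ _ theta 'I_n B phi sigma c q Z F2 L W).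
    - by move=> y; rewrite !in_setU !negb_or => /andP[/andP[/act]].
    - exact: valL.
    - exact: thetaL.
    - by move=> y; rewrite !in_setU !negb_or inE => /andP[/andP[_ ->]].
    - exact: pieces.
    - exact: q_free.
    - by rewrite lettersF // mem_head.
    - exact: sF.
    - by rewrite mem_head.
    - exact: red.
    - exact: leq_bigmax_seq.
    move=> s0 g1; apply: x1; rewrite -[x]reprK -hnn_pi_nil; apply/hnn_piP.
    by apply: HnnTrans xnf _; rewrite s0 g1; apply: HnnOne.
  apply: leq_trans (agree1_le _ w) _.
  by rewrite /T mulnDl leq_add.
move=> x y xF yF; apply: leT; rewrite -ev_word_cat.
apply: leq_trans (_ : N * e <= _); last by rewrite leq_mul // leq_addr.
apply: (stab (repr x ++ repr (x^-1 * y : HNN theta)%g, repr y)) near.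
by rewrite mem_cat; apply/orP; left; apply/allpairsP; exists (x, y).
Qed.
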